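(* Let $K$ be the field of Puiseux series described in the context, let $A$ be an $n\times d$ matrix over $K$, and let $L\subset K^n$ be its image (column space). Then the equality $\deg(L) = \mathrm{im}(\deg(A))$ of subsets of $\mathbb{T}^n$ holds if and only if every cocircuit in $L$ is represented in $A$, i.e. for every cocircuit $c\in L$ some column of $A$ is a non-zero scalar multiple (over $K$) of $c$.
   Context: $K$ is the field of series $\sum_{a \in I} c_a x^a$ where $c_a \in \mathbb{C}$ and $I$ is a locally finite subset of $\mathbb{R}$ with a least element. Let $\mathbb{T} = \mathbb{R}\cup\{\infty\}$ with $\oplus = \min$ and $\odot = +$. The map $\deg : K \to \mathbb{T}$ sends a non-zero series to its lowest exponent and $0$ to $\infty$, and is applied entrywise to vectors and matrices; $\deg(L)=\{\deg(v): v\in L\}\subset\mathbb{T}^n$ (this is the realizable tropical linear space of $L$). The matrix $\deg(A)$ defines the tropical linear map $\mathbb{T}^d\to\mathbb{T}^n$, $v\mapsto \deg(A)\odot v$, where $(\deg(A)\odot v)_i=\min_{1\le j\le d}(\deg(A_{ij})+v_j)$, and $\mathrm{im}(\deg(A))$ is the image of this map. The support of a vector in $K^n$ is the set of indices of its non-zero coordinates. A cocircuit of $L$ is a nonzero element of $L$ whose support is minimal with respect to inclusion among supports of nonzero elements of $L$; two cocircuits with the same support are scalar multiples of each other. *)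

(* Defs.v *)
From HB Require Import structures.
From mathcomp Require Import all_boot all_order all_algebra.
From mathcomp Require Import finmap complex lra.
From mathcomp Require Import all_classical all_reals.
Set Implicit Arguments.
Unset Strict Implicit.
Unset Printing Implicit Defensive.
Import Order.TTheory GRing.Theory Num.Theory.
Local Open Scope classical_set_scope.
Local Open Scope ring_scope.

(* The coefficient field C is [R[i]], the complex numbers over R. *)
Section Puiseux.
Variable R : realType.

Definition locally_finite (I : set R) : Prop :=
  forall a b : R, finite_set (I `&` [set x | a <= x <= b]).

Definition has_least (I : set R) : Prop :=
  exists2 a, I a & forall b, I b -> a <= b.

Lemma least_below (S : set R) :
  (forall t, finite_set [set a | a <= t /\ S a]) ->
  forall a, S a -> has_least S.
Proof.
move=> fin a Sa.
have seqmin (x : R) (s : seq R) :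
    exists2 m, m \in x :: s & forall y, y \in x :: s -> m <= y.
  elim: s x => [|y s IH] x.
    by exists x; rewrite ?mem_head// => y; rewrite inE => /eqP ->.
  have [m ms mle] := IH y; have [xm|mx] := leP x m.
    exists x; rewrite ?mem_head// => z; rewrite inE => /predU1P[->//|/mle].
    exact: le_trans.
  exists m; first by rewrite inE ms orbT.
  by move=> z; rewrite inE => /predU1P[->|/mle//]; exact: ltW.
have /finite_seqP[s Es] := fin a.
have ins b : b <= a -> S b -> b \in s.
  by move=> ba Sb; have : [set b | b <= a /\ S b] b by []; rewrite Es.
case: s Es ins => [|x s] Es ins; first by have := ins _ (lexx a) Sa.
have [m ms mle] := seqmin x s.
have [ma Sm] : [set b | b <= a /\ S b] m by rewrite Es.
exists m => // b Sb; have [ba|/ltW ab] := leP b a; first exact/mle/ins.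
exact: le_trans ab.
Qed.

Definition is_puiseux : {pred R -> R[i]} :=
  fun f => `[< exists I : set R, [/\ locally_finite I, has_least I &
                                 forall a, ~ I a -> f a = 0] >].

(* A series is represented by its coefficient function [a |-> c_a]. *)
Record puiseux := Puiseux {
  coef :> R -> R[i];
  _ : coef \in is_puiseux }.

HB.instance Definition _ := [isSub for coef].
HB.instance Definition _ := [Choice of puiseux by <:].

Lemma is_puiseuxP (f : R -> R[i]) :
  f \in is_puiseux <-> forall t, finite_set [set a | a <= t /\ f a != 0].
Proof.
split=> [/asboolP [I [lfI [m Im leI] fI]] t | fin].
  apply: sub_finite_set (lfI m t) => a [at_ fa].
  have Ia : I a by apply: contrapT => /fI fa0; rewrite fa0 eqxx in fa.
  by split=> //=; rewrite leI.
have [[a fa]|nf] := pselect (exists a, f a != 0); last first.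
  apply/asboolP; exists [set 0]; split.
  - by move=> a b; apply: sub_finite_set (finite_set1 0) => x [].
  - by exists 0 => // b ->.
  - by move=> b _; apply: contrapT => /eqP fb; apply: nf; exists b.
apply/asboolP; exists [set b | f b != 0]; split.
- by move=> b c; apply: sub_finite_set (fin c) => x /= [fx /andP[_ xc]].
- exact: (least_below fin fa).
- by move=> b /negP; rewrite negbK => /eqP.
Qed.

Lemma puiseux_finite (f : puiseux) t : finite_set [set a | a <= t /\ f a != 0].
Proof. by move: t; apply/is_puiseuxP; case: f. Qed.

Lemma puiseux_has_least (f : R -> R[i]) : f \in is_puiseux ->
  (exists a, f a != 0) ->
  exists2 m, f m != 0 & forall b, f b != 0 -> m <= b.
Proof.
by move=> /is_puiseuxP fin [a fa]; exact: (@least_below [set b | f b != 0] _ a).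
Qed.

Lemma puiseux_lb (f : puiseux) : exists m, forall b, f b != 0 -> m <= b.
Proof.
have [ef|nf] := pselect (exists a, f a != 0).
  have [m _ ?] := puiseux_has_least (valP f) ef; by exists m.
by exists 0 => b fb; case: nf; exists b.
Qed.

Lemma is_puiseux_zmod : zmod_closed is_puiseux.
Proof.
split=> [|f g /is_puiseuxP fin /is_puiseuxP gin]; apply/is_puiseuxP => t.
  by apply: sub_finite_set (finite_set0 _) => a [_]; rewrite eqxx.
have : finite_set ([set a | a <= t /\ f a != 0] `|` [set a | a <= t /\ g a != 0]).
  by rewrite finite_setU.
apply: sub_finite_set => a [at_ fga].
have [fa|fa] := eqVneq (f a) 0; [right|by left].
split=> //; apply: contra fga => /eqP ga.
by rewrite -[X in X == _]/(f a - g a) fa ga subrr.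
Qed.

HB.instance Definition _ := GRing.isZmodClosed.Build _ is_puiseux is_puiseux_zmod.
HB.instance Definition _ := [SubChoice_isSubZmodule of puiseux by <:].

Lemma coefD (f g : puiseux) a : (f + g) a = f a + g a. Proof. by []. Qed.
Lemma coefN (f : puiseux) a : (- f) a = - f a. Proof. by []. Qed.
Lemma coefB (f g : puiseux) a : (f - g) a = f a - g a. Proof. by []. Qed.
Lemma coef0 a : (0 : puiseux) a = 0. Proof. by []. Qed.
Lemma coef_sum (J : Type) (r : seq J) (P : pred J) (F : J -> puiseux) a :
  (\sum_(j <- r | P j) F j) a = \sum_(j <- r | P j) F j a.
Proof.
by elim/big_rec2: _ => // j x y _ <-.
Qed.

Lemma puiseux_eqP (f g : puiseux) : (forall a, f a = g a) -> f = g.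
Proof. by move=> fg; apply: val_inj; apply/funext. Qed.

(* The sum has finitely many non-zero terms, see [cauchy_supp_finite]. *)
Definition cauchy (f g : R -> R[i]) : R -> R[i] :=
  fun c => \sum_(a \in [set: R]) f a * g (c - a).

Lemma cauchyE (f g : R -> R[i]) (c : R) (A : {fset R}) :
  (forall a, f a != 0 -> g (c - a) != 0 -> a \in A) ->
  cauchy f g c = \sum_(a <- A) f a * g (c - a).
Proof.
move=> fgA; apply: fsbigTE => a aA.
have [->|fa] := eqVneq (f a) 0; first by rewrite mul0r.
have [->|ga] := eqVneq (g (c - a)) 0; first by rewrite mulr0.
by have := fgA _ fa ga; rewrite (negbTE aA).
Qed.

Lemma cauchyC (f g : R -> R[i]) : cauchy f g = cauchy g f.
Proof.
apply/funext => c; rewrite /cauchy (@reindex_fsbigT _ _ _ _ _ (fun a => c - a)).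
  by apply: eq_fsbigr => a _; rewrite subKr mulrC.
by exists (fun a => c - a) => a; rewrite subKr.
Qed.

Lemma cauchy_neq0 (f g : R -> R[i]) c :
  cauchy f g c != 0 -> exists2 a, f a != 0 & g (c - a) != 0.
Proof.
move=> fgc; apply: contrapT => nex; move/eqP: fgc; apply; apply: fsbig1 => a _.
have [->|fa] := eqVneq (f a) 0; first by rewrite mul0r.
have [->|ga] := eqVneq (g (c - a)) 0; first by rewrite mulr0.
by case: nex; exists a.
Qed.

Lemma cauchy_supp_finite (f g : puiseux) c :
  finite_set [set a | f a * g (c - a) != 0].
Proof.
have [m gm] := puiseux_lb g.
apply: sub_finite_set (puiseux_finite f (c - m)) => a /=.
rewrite mulf_eq0 negb_or => /andP[fa /gm]; rewrite lerBrDr addrC -lerBrDr.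
by rewrite lerBrDl -lerBrDr.
Qed.

Lemma cauchy_is_puiseux (f g : puiseux) : cauchy f g \in is_puiseux.
Proof.
have [mf fm] := puiseux_lb f; have [mg gm] := puiseux_lb g.
apply/is_puiseuxP => t.
have fin := finite_image (fun p => p.1 + p.2)
  (finite_setX (puiseux_finite f (t - mg)) (puiseux_finite g (t - mf))).
apply: sub_finite_set fin => c [ct /cauchy_neq0[a fa ga]].
exists (a, c - a); last by rewrite /= addrC subrK.
have := fm _ fa; have := gm _ ga => h1 h2.
split; split => //=; first by rewrite lerBrDr (le_trans _ ct)// -lerBrDl.
by rewrite lerB.
Qed.

Definition pmul (f g : puiseux) : puiseux := Puiseux (cauchy_is_puiseux f g).

Lemma monomial_is_puiseux (a : R) (c : R[i]) :
  (fun b : R => if b == a then c else 0) \in is_puiseux.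
Proof.
apply/is_puiseuxP => t; apply: sub_finite_set (finite_set1 a) => b [_] /=.
by have [->//|_] := eqVneq b a; rewrite eqxx.
Qed.

Definition monomial (a : R) (c : R[i]) : puiseux :=
  Puiseux (monomial_is_puiseux a c).

Lemma pmul_monomial a c (f : puiseux) b :
  pmul (monomial a c) f b = c * f (b - a).
Proof.
rewrite /= (@cauchyE _ _ _ [fset a]%fset) => [|x].
  by rewrite big_seq_fset1 /= eqxx.
by rewrite inE; case: ifP => //; rewrite eqxx.
Qed.

Lemma pmulC : commutative pmul.
Proof. by move=> f g; apply: val_inj; rewrite /= cauchyC. Qed.

Lemma pmulA : associative pmul.
Proof.
move=> f g h; apply: puiseux_eqP => c /=.
have [mf fm] := puiseux_lb f; have [mg gm] := puiseux_lb g.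
have [mh hm] := puiseux_lb h.
pose A := fset_set [set a | a <= c - mg - mh /\ f a != 0].
pose C := fset_set [set a | a <= c - mf - mg /\ h a != 0].
have AE a : (a \in A) = (a <= c - mg - mh) && (f a != 0).
  by rewrite in_fset_set ?inE; [exact/asboolP/andP | exact: puiseux_finite].
have CE a : (a \in C) = (a <= c - mf - mg) && (h a != 0).
  by rewrite in_fset_set ?inE; [exact/asboolP/andP | exact: puiseux_finite].
rewrite (@cauchyE _ _ _ A); last first.
  move=> a fa /cauchy_neq0[b /gm gb /hm hb]; rewrite AE fa andbT.
  by move: gb hb; lra.
rewrite (cauchyC (cauchy f g)) (@cauchyE _ _ _ C); last first.
  move=> e he /cauchy_neq0[a fa gb]; rewrite CE he andbT.
  by have := fm _ fa; have := gm _ gb; lra.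
transitivity (\sum_(a <- A) \sum_(e <- C) f a * (g (c - a - e) * h e)).
  rewrite big_seq [RHS]big_seq; apply: eq_bigr => a; rewrite AE => /andP[_ fa].
  rewrite -mulr_sumr cauchyC (@cauchyE _ _ _ C).
    by congr (_ * _); apply: eq_bigr => e _; rewrite mulrC.
  move=> e he /gm gb; rewrite CE he andbT.
  by move: gb; have := fm _ fa; lra.
rewrite exchange_big /= big_seq [RHS]big_seq.
apply: eq_bigr => e; rewrite CE => /andP[_ he].
rewrite mulrC (@cauchyE _ _ _ A).
  by rewrite mulr_suml; apply: eq_bigr => a _; rewrite mulrA addrAC.
move=> a fa /gm gb; rewrite AE fa andbT.
by move: gb; have := hm _ he; lra.
Qed.

Lemma pmul1 : left_id (monomial 0 1) pmul.
Proof. by move=> f; apply: puiseux_eqP => a; rewrite pmul_monomial mul1r subr0. Qed.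

Lemma pmulD : left_distributive pmul +%R.
Proof.
move=> f g h; apply: puiseux_eqP => c; rewrite coefD /=.
have [m hm] := puiseux_lb h.
pose A := fset_set ([set a | a <= c - m /\ f a != 0] `|`
                    [set a | a <= c - m /\ g a != 0]).
have AE a : (a \in A) = (a <= c - m) && ((f a != 0) || (g a != 0)).
  rewrite in_fset_set; last by rewrite finite_setU; split; exact: puiseux_finite.
  apply/idP/idP => [/set_mem [] [-> ->]|/andP[am /orP fga]]; rewrite ?orbT//.
  by apply: mem_set; case: fga; [left|right].
have cm a : h (c - a) != 0 -> a <= c - m by move=> /hm; lra.
rewrite (@cauchyE _ _ _ A) => [|a fga /cm am]; last first.
  rewrite AE am /= -negb_and; apply: contra fga => /andP[/eqP fa /eqP ga].
  by rewrite -[X in X == _]/(f a + g a) fa ga addr0.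
rewrite (@cauchyE _ _ _ A) => [|a fa /cm am]; last by rewrite AE am fa.
rewrite (@cauchyE _ _ _ A) => [|a ga /cm am]; last by rewrite AE am ga orbT.
by rewrite -big_split; apply: eq_bigr => a _; rewrite /= -mulrDl.
Qed.

Lemma monomial01_neq0 : monomial 0 1 != 0.
Proof.
apply/eqP => /(congr1 (fun f : puiseux => f 0)) /= /eqP.
by rewrite eqxx oner_eq0.
Qed.

HB.instance Definition _ :=
  GRing.Zmodule_isComNzRing.Build puiseux pmulA pmulC pmul1 pmulD monomial01_neq0.

Lemma coefM (f g : puiseux) c : (f * g) c = \sum_(a \in [set: R]) f a * g (c - a).
Proof. by []. Qed.

Lemma coef1 a : (1 : puiseux) a = (a == 0)%:R.
Proof. by rewrite -[LHS]/(if a == 0 then 1 else 0); case: eqP. Qed.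

Lemma coef_monomialM a c (f : puiseux) b : (monomial a c * f) b = c * f (b - a).
Proof. exact: pmul_monomial. Qed.

Lemma puiseux_exp_supp (u : puiseux) (e : R) (k : nat) :
  (forall a, u a != 0 -> e <= a) -> forall a, (u ^+ k) a != 0 -> e *+ k <= a.
Proof.
move=> ue; elim: k => [|k IH] a.
  by rewrite expr0 coef1; have [->|_] := eqVneq a 0; rewrite ?eqxx.
rewrite exprS => /cauchy_neq0[b /ue eb /IH ekb].
by rewrite mulrS; move: ekb; lra.
Qed.

Lemma puiseux_geometric (u : puiseux) :
  (forall a, u a != 0 -> 0 < a) -> exists g, g * (1 - u) = 1.
Proof.
move=> u0.
have [e e0 ue] : exists2 e : R, 0 < e & forall a, u a != 0 -> e <= a.
  have [eu|nu] := pselect (exists a, u a != 0).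
    by have [e ue ?] := puiseux_has_least (valP u) eu; exists e => //; exact: u0.
  by exists 1 => // a ua; case: nu; exists a.
pose G N := \sum_(k < N) u ^+ k.
pose N t := Num.bound `|t / e|.
have NP t : t < e *+ N t.
  rewrite -mulr_natr mulrC -ltr_pdivrMr//.
  by apply: le_lt_trans (ler_norm _) _; exact: archi_boundP.
have expu (t : R) n k : t < e *+ n -> (n <= k)%N -> (u ^+ k) t = 0.
  move=> tn nk; apply/eqP; apply: contraTT tn => /(puiseux_exp_supp ue) ekt.
  by rewrite -leNgt (le_trans _ ekt)// ler_wpMn2l// ltW.
have Gstab (t : R) n : t < e *+ n -> G n t = G (N t) t.
  move=> tn; pose M := maxn n (N t).
  have aux p : t < e *+ p -> (p <= M)%N -> G p t = G M t.
    move=> tp pM; rewrite /G !coef_sum -!(big_mkord xpredT (fun k => (u ^+ k) t)).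
    rewrite (big_cat_nat (n := p) (p := M))//= [X in _ + X]big1_seq ?addr0//.
    by move=> k; rewrite mem_index_iota => /andP[_ /andP[pk _]]; exact: (expu _ p).
  by rewrite !aux ?leq_maxl ?leq_maxr.
have gP : (fun t => G (N t) t) \in is_puiseux.
  apply/is_puiseuxP => t; apply: sub_finite_set (puiseux_finite (G (N t)) t).
  move=> a [at_ ga]; split=> //=.
  by rewrite (Gstab a)// (le_lt_trans at_).
exists (Puiseux gP); apply: puiseux_eqP => t.
have -> : (Puiseux gP * (1 - u)) t = (G (N t) * (1 - u)) t.
  rewrite !coefM; apply: eq_fsbigr => a _; have [at_|ta] := leP a t.
    by rewrite /= -(Gstab a (N t))// (le_lt_trans at_).
  suff -> : (1 - u) (t - a) = 0 by rewrite !mulr0.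
  rewrite coefB coef1; have -> : u (t - a) = 0.
    by apply/eqP; apply/negP => /negP/u0; move: ta; lra.
  by rewrite subr0; case: eqP => //= ta0; exfalso; move: ta; lra.
have -> : G (N t) * (1 - u) = 1 - u ^+ N t.
  by rewrite mulrC -[in RHS](expr1n _ (N t)) subrXX; congr (_ * _);
    apply: eq_bigr => k _; rewrite expr1n mul1r.
by rewrite coefB (expu t (N t))// subr0.
Qed.

Lemma puiseux_invertible (f : puiseux) : f != 0 -> exists g, g * f = 1.
Proof.
move=> f0; have ef : exists a, f a != 0.
  apply: contrapT => nf; move/eqP: f0; apply; apply: puiseux_eqP => a.
  by apply/eqP/negP => /negP fa; apply: nf; exists a.
have [m fm mle] := puiseux_has_least (valP f) ef.
pose h := monomial (- m) (f m)^-1 * f.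
have [g gh] : exists g, g * (1 - (1 - h)) = 1.
  apply: puiseux_geometric => a; rewrite coefB coef1 coef_monomialM opprK.
  have [->|a0] := eqVneq a 0; first by rewrite add0r mulVf// subrr eqxx.
  rewrite sub0r oppr_eq0 mulf_eq0 negb_or => /andP[_ /mle].
  by rewrite lerDr le_eqVlt eq_sym (negbTE a0).
by exists (g * monomial (- m) (f m)^-1); rewrite -mulrA -/h -{}gh subKr.
Qed.

(* By [puiseux_invertible] the set below is non-empty unless f = 0. *)
Definition pinv (f : puiseux) : puiseux := xget 0 [set g | g * f = 1].

Lemma pmulV (f : puiseux) : f != 0 -> pinv f * f = 1.
Proof. by move=> /puiseux_invertible[g gf]; rewrite /pinv; case: xgetP => // /(_ g). Qed.

Lemma pinv0 : pinv 0 = 0.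
Proof.
rewrite /pinv; case: xgetP => // g _ /= /eqP.
by rewrite mulr0 eq_sym oner_eq0.
Qed.

HB.instance Definition _ := GRing.ComNzRing_isField.Build puiseux pmulV pinv0.

(* The default value of [xget] is never used, see [degP]. *)
Definition deg (f : puiseux) : \bar R :=
  if f == 0 then +oo%E
  else (xget 0 [set a | f a != 0 /\ forall b, f b != 0 -> a <= b])%:E.

Lemma deg0 : deg 0 = +oo%E. Proof. by rewrite /deg eqxx. Qed.

Lemma degP (f : puiseux) : f != 0 ->
  exists a, [/\ deg f = a%:E, f a != 0 & forall b, f b != 0 -> a <= b].
Proof.
move=> f0; have ef : exists a, f a != 0.
  apply: contrapT => nf; move/eqP: f0; apply; apply: puiseux_eqP => a.
  by apply/eqP/negP => /negP fa; apply: nf; exists a.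
have [m fm mle] := puiseux_has_least (valP f) ef.
rewrite /deg (negbTE f0); case: xgetP => [a _ [fa ale]|/(_ m) []//].
by exists a.
Qed.

(* T = R u {oo} is the set of extended reals other than -oo; [deg] takes
   its values there (in \bar R, -oo + +oo = -oo). *)
Definition trop_space (d : nat) : set 'cV[\bar R]_d :=
  [set v | forall j, v j 0 != -oo%E].

Definition trop_mulmx (n d : nat) (M : 'M[\bar R]_(n, d)) (v : 'cV[\bar R]_d) :
  'cV[\bar R]_n := \col_i \big[mine/+oo%E]_(j < d) (M i j + v j 0%R)%E.

Definition trop_image (n d : nat) (M : 'M[\bar R]_(n, d)) : set 'cV[\bar R]_n :=
  trop_mulmx M @` @trop_space d.

Definition deg_set (n : nat) (L : set 'cV[puiseux]_n) : set 'cV[\bar R]_n :=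
  map_mx deg @` L.

Definition col_space (n d : nat) (A : 'M[puiseux]_(n, d)) : set 'cV[puiseux]_n :=
  range (fun x : 'cV[puiseux]_d => A *m x).

Definition supp (n : nat) (v : 'cV[puiseux]_n) : {set 'I_n} :=
  [set i | v i 0 != 0]%SET.

Definition cocircuit (n : nat) (L : set 'cV[puiseux]_n) (c : 'cV[puiseux]_n) : Prop :=
  [/\ L c, c != 0 &
      forall v, L v -> v != 0 -> supp v \subset supp c -> supp v = supp c].

Definition represented (n d : nat) (A : 'M[puiseux]_(n, d)) (c : 'cV[puiseux]_n) :
  Prop := exists j, exists2 k : puiseux, k != 0 & col j A = k *: c.

End Puiseux.

(* Main.v *)
Require Import Defs.
From mathcomp Require Import all_boot all_order all_algebra.
From mathcomp Require Import finmap complex.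
From mathcomp Require Import all_classical all_reals.
Set Implicit Arguments.
Unset Strict Implicit.
Unset Printing Implicit Defensive.
Import Order.TTheory GRing.Theory Num.Theory.
Local Open Scope classical_set_scope.
Local Open Scope ring_scope.

(** Write [L] for the column space of [A].

    If the two sets agree and [c] is a cocircuit, then [deg c] is a tropical
    combination of the columns of [deg A]. A column [j] with a finite
    coefficient can only be non-zero where [c] is, since elsewhere the minimum
    would be finite; one such column is non-zero, because [c] is. By
    minimality of the support of [c] it is a multiple of [c]
    ([represented_of_deg_set_eq]).

    The inclusion of the tropical image in [deg L] is true for every matrix. To
    realize the coefficients [v], take [x_j] to be a complex multiple of the
    monomial with exponent [v_j]. In each row the coefficient of [A *m x] at the
    tropical value is a linear form in these complex numbers, non-zero as
    soon as that value is finite, and finitely many such forms are all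
    non-zero at the powers of some [z] ([trop_image_sub_deg_set]).

    For the other inclusion, let [y] be in [L] and [i] in its support. If
    [supp z] is strictly contained in [supp y] for some non-zero [z] of [L],
    one can scale [z] to [a *: z] so that it cancels an entry of [y] while
    [deg (a *: z) >= deg y] ([elimination]). In the decomposition
    [y = (y - a *: z) + a *: z] both terms have smaller support and degree at
    least that of [y], and by the ultrametric inequality one of them has degree
    exactly [deg (y i)] at [i]. Iterating yields a cocircuit [c] with
    [deg c >= deg y], with equality at [i] ([cocircuit_dominating]). So
    [deg y] is the minimum of the degrees of finitely many cocircuits; if each
    is a multiple of a column of [A], that minimum lies in the tropical image
    ([trop_image_dominated]). *)

(** * The valuation deg *)

Section Valuation.
Variable R : realType.
Implicit Types (f g : puiseux R) (t a : R) (u : \bar R).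

Lemma deg_eqy f : (deg f == +oo%E) = (f == 0).
Proof.
have [->|/degP[a [-> _ _]]] := eqVneq f 0; first by rewrite deg0 eqxx.
by [].
Qed.

Lemma deg_neqNy f : deg f != -oo%E.
Proof.
by have [->|/degP[a [-> _ _]]] := eqVneq f 0; first by rewrite deg0.
Qed.

Lemma deg_le f a : f a != 0 -> (deg f <= a%:E)%E.
Proof.
move=> fa; have [f0|/degP[b [-> _ /(_ _ fa)]]] := eqVneq f 0.
  by move: fa; rewrite f0 Defs.coef0 eqxx.
by rewrite lee_fin.
Qed.

Lemma le_deg f t : (forall a, f a != 0 -> t <= a) -> (t%:E <= deg f)%E.
Proof.
move=> ft; have [->|/degP[a [-> fa _]]] := eqVneq f 0.
  by rewrite deg0 leey.
by rewrite lee_fin ft.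
Qed.

(** The coefficient of [f * g] at the sum of the two lowest exponents is a
    single product of leading coefficients, so nothing can cancel there. *)
Lemma degM f g : deg (f * g) = (deg f + deg g)%E.
Proof.
have [->|f0] := eqVneq f 0.
  by rewrite mul0r deg0 addye// deg_neqNy.
have [->|g0] := eqVneq g 0.
  by rewrite mulr0 deg0 addey// deg_neqNy.
have [a [-> fa fle]] := degP f0; have [b [-> gb gle]] := degP g0.
apply/le_anti/andP; split; last first.
  apply: le_deg => c /cauchy_neq0[x /fle ax /gle].
  by rewrite lerBrDl => /(le_trans _)-> //; rewrite lerD2r.
apply: deg_le; rewrite -[X in X != 0]/(cauchy f g (a + b)).
rewrite (@cauchyE _ _ _ _ [fset a]%fset) => [|x /fle ax /gle].
  by rewrite big_seq_fset1 addrAC subrr add0r mulf_neq0.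
rewrite inE addrAC lerDr subr_ge0 => xa.
by rewrite eq_le xa ax.
Qed.

(** The ultrametric inequality: a non-zero coefficient of a sum comes from one
    of the summands. *)
Lemma degD u f g : (u <= deg f)%E -> (u <= deg g)%E -> (u <= deg (f + g)%R)%E.
Proof.
have [->|/degP[a [-> fga _]]] := eqVneq (f + g) 0; first by rewrite deg0 leey.
have [fa|fa] := eqVneq (f a) 0 => uf ug; last exact: le_trans (deg_le fa).
apply: le_trans ug (deg_le _).
by move: fga; rewrite Defs.coefD fa add0r.
Qed.

Lemma degN f : deg (- f) = deg f.
Proof.
suff le_N (h : puiseux R) : (deg h <= deg (- h)%R)%E.
  by apply/le_anti; rewrite le_N -{2}(opprK f) le_N.
have [->|/degP[a [-> ha hle]]] := eqVneq h 0; first by rewrite oppr0.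
by apply: le_deg => b; rewrite Defs.coefN oppr_eq0 => /hle.
Qed.

Lemma deg_sum (I : finType) (F : I -> puiseux R) u :
  (forall i, (u <= deg (F i))%E) -> (u <= deg (\sum_i F i)%R)%E.
Proof.
move=> uF; elim/big_ind: _ => //; first by rewrite deg0 leey.
by move=> f g; exact: degD.
Qed.

Lemma deg_monomial a (c : R[i]) : (a%:E <= deg (monomial a c))%E.
Proof.
apply: le_deg => b; rewrite -[monomial a c b]/(if b == a then c else 0).
by have [->|_] := eqVneq b a; rewrite ?eqxx.
Qed.

End Valuation.

(** * Tropical column spans *)

Section TropicalImage.
Variables (R : realType) (n d : nat).

(** A vector lies in the span as soon as it is dominated by members of the span
    that touch it at each finite coordinate: it is then their coordinatewise
    minimum, and tropical maps commute with minima. *)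
Lemma trop_image_dominated (M : 'M[\bar R]_(n, d)) (u : 'cV[\bar R]_n) :
  (forall i j, M i j != -oo%E) ->
  (forall i, u i 0 != +oo%E -> exists w, [/\ trop_image M w,
     forall l, (u l 0%R <= w l 0%R)%E & (w i 0%R <= u i 0%R)%E]) ->
  trop_image M u.
Proof.
move=> MNy uM.
(* At an infinite coordinate of [u] the all-infinite coefficient vector, whose
   image is infinite everywhere, works. *)
have /choice[W WP] : forall i, exists x : 'cV[\bar R]_d, [/\ trop_space x,
    forall l j, (u l 0%R <= M l j + x j 0%R)%E &
    (trop_mulmx M x i 0%R <= u i 0%R)%E].
  move=> i; have [ui|/uM[_ [[x Tx <-] ux xu]]] := eqVneq (u i 0) +oo%E.
    exists (const_mx +oo%E); split; last by rewrite ui leey.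
      by move=> j; rewrite mxE.
    by move=> l j; rewrite mxE addey// leey.
  exists x; split=> // l j; apply: le_trans (ux l) _.
  by rewrite mxE bigmin_le_cond.
pose v : 'cV[\bar R]_d := \col_j \big[mine/+oo%E]_(i < n) W i j 0.
exists v.
  move=> j; rewrite mxE; elim/big_ind: _ => // [x y x0 y0|i _].
    by rewrite minEle; case: ifP.
  by have [/(_ j)] := WP i.
apply/colP => i; rewrite mxE; apply/le_anti/andP; split.
  have [_ _] := WP i; apply: le_trans; rewrite mxE.
  apply: le_bigmin2 => j _; rewrite leeD2l// mxE.
  exact: bigmin_le_cond.
apply: le_bigmin => [|j _]; first by rewrite leey.
rewrite mxE; elim/big_ind: _ => [|x y ux uy|k _].
- by rewrite addey// leey.
- by rewrite minEle; case: ifP.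
- by have [_] := WP k.
Qed.

Lemma trop_image_col (A : 'M[puiseux R]_(n, d)) j (k : puiseux R) :
  trop_image (map_mx (@deg R) A) (map_mx (@deg R) (k *: col j A)).
Proof.
exists (\col_l (if l == j then deg k else +oo%E)).
  by move=> l; rewrite mxE; case: ifP => // _; exact: deg_neqNy.
apply/colP => i; rewrite !mxE degM addeC; apply/le_anti/andP; split.
  apply: le_trans (bigmin_le _ j _) _.
  by rewrite !mxE eqxx.
apply: le_bigmin => [|l _]; first by rewrite leey.
rewrite !mxE; case: eqP => [->//|_].
by rewrite addey ?leey// deg_neqNy.
Qed.

End TropicalImage.

(** * Realizing tropical combinations by generic coefficients *)

(** A polynomial has finitely many roots, and the natural numbers embed in
    characteristic zero. *)
Lemma poly_nonroot (F : numDomainType) (p : {poly F}) :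
  p != 0 -> exists z, ~~ root p z.
Proof.
move=> p0; apply: contrapT => nz.
suff : (size [seq k%:R : F | k <- iota 0 (size p)] < size p)%N.
  by rewrite size_map size_iota ltnn.
apply: max_poly_roots => //.
  by apply/allP => z _; apply: contrapT => /negP rz; apply: nz; exists z.
by rewrite map_inj_uniq ?iota_uniq//; apply: mulrIn; exact: oner_neq0.
Qed.

Section Generic.
Variables (R : realType) (n d : nat).

(** Taking the complex coefficients to be the powers of a single [z] turns the
    condition that no leading terms cancel in row [i] into the
    non-vanishing at [z] of one polynomial [P i]. *)
Lemma trop_image_sub_deg_set (A : 'M[puiseux R]_(n, d)) :
  trop_image (map_mx (@deg R) A) `<=` deg_set (col_space A).
Proof.
move=> _ [v Tv <-]; set M := map_mx _ A.
pose e j := fine (v j 0).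
pose m i := trop_mulmx M v i 0.
(* [B i j * z ^+ j] is the coefficient of [A i j * x j] at exponent [m i],
   when that exponent is finite. *)
pose B i j := if v j 0 == +oo%E then 0 else A i j (fine (m i) - e j).
pose P i : {poly R[i]} := \sum_(j < d) B i j *: 'X^j.
have [z zP] : exists z, forall i, P i != 0 -> (P i).[z] != 0.
  have [|z] := @poly_nonroot _ (\prod_(i < n | P i != 0) P i).
    exact/prodf_neq0.
  by rewrite /root horner_prod => /prodf_neq0 zP; exists z => i /zP.
pose x : 'cV[puiseux R]_d :=
  \col_j (if v j 0 == +oo%E then 0 else monomial (e j) (z ^+ j)).
have vx j : (v j 0%R <= deg (x j 0%R))%E.
  rewrite mxE; have [_|vy] := eqVneq; first by rewrite deg0 leey.
  by apply: le_trans (deg_monomial _ _); rewrite fineK// fin_numE Tv.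
exists (A *m x); first by exists x.
apply/colP => i; rewrite mxE; apply/le_anti/andP; split; last first.
  rewrite mxE mxE; apply: deg_sum => j; rewrite degM.
  apply: le_trans (bigmin_le _ j _) _.
  by rewrite mxE leeD2l.
rewrite -/(m i).
(* Some column [j] attains the minimum, unless the minimum is infinite. *)
have : (m i <= m i)%E by [].
rewrite {1}/m mxE => /bigmin_leP[|[j _]].
  by rewrite leye_eq => /eqP->; rewrite leey.
have mj : (m i <= M i j + v j 0%R)%E by rewrite /m mxE bigmin_le.
move=> jm.
have {jm mj} : m i = (M i j + v j 0%R)%E by apply/le_anti; rewrite mj jm.
rewrite mxE; have [->|vy] := eqVneq (v j 0) +oo%E.
  by rewrite addey ?deg_neqNy// => ->; rewrite leey.
have vE : v j 0 = (e j)%:E by rewrite fineK// fin_numE Tv.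
have [->|/degP[a [-> fa _]]] := eqVneq (A i j) 0.
  by rewrite deg0 vE => ->; rewrite leey.
rewrite vE -EFinD => mE; rewrite mE; apply: deg_le.
(* The leading coefficient [A i j a] is the coefficient of ['X^j] in [P i]. *)
have Pi : P i != 0.
  apply: contra_neq fa => /(congr1 (fun p : {poly _} => p`_j)).
  rewrite poly.coef_sum poly.coef0 (bigD1 j)//= big1 => [|k kj].
    by rewrite coefZ coefXn eqxx mulr1 addr0 /B (negbTE vy) mE /= addrK.
  by rewrite coefZ coefXn eq_sym (inj_eq val_inj) (negbTE kj) mulr0.
suff -> : (A *m x) i 0 (a + e j) = (P i).[z] by exact: zP.
rewrite mxE Defs.coef_sum horner_sum; apply: eq_bigr => k _.
rewrite hornerZ hornerXn /B mE mxE; case: ifP => _.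
  by rewrite mulr0 mul0r.
by rewrite mulrC coef_monomialM mulrC.
Qed.

End Generic.

(** * Cocircuits *)

Section Cocircuits.
Variables (R : realType) (n : nat).
Implicit Types (L : set 'cV[puiseux R]_n) (y z c : 'cV[puiseux R]_n).

Definition linear_space L :=
  forall (a : puiseux R) y z, L y -> L z -> L (a *: y + z).

Lemma col_space_linear d (A : 'M[puiseux R]_(n, d)) :
  linear_space (col_space A).
Proof.
move=> a _ _ [x _ <-] [y _ <-]; exists (a *: x + y) => //.
by rewrite mulmxDr scalemxAr.
Qed.

Lemma linear_spaceZ L a y : linear_space L -> L y -> L (a *: y).
Proof.
by move=> Llin Ly; rewrite -[a](subrK 1) scalerDl scale1r; exact: Llin.
Qed.

Lemma suppP y i : reflect (y i 0 <> 0) (i \in supp y).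
Proof. by rewrite inE; apply: (iffP idP) => /eqP. Qed.

Lemma supp_neq0 y i : i \in supp y -> y != 0.
Proof. by move/suppP => yi; apply/eqP => y0; apply: yi; rewrite y0 mxE. Qed.

Lemma neq0_supp y : y != 0 -> exists i, i \in supp y.
Proof.
move=> y0; apply: contrapT => ny; move/eqP: y0; apply.
apply/colP => i; rewrite mxE; apply: contrapT => /suppP yi.
by apply: ny; exists i.
Qed.

(** Subtracting from [y] the multiple of [c] that cancels one entry leaves a
    vector whose support lies in [supp c] but misses an index of it, so this
    vector is zero by minimality. *)
Lemma cocircuit_colinear L c y : linear_space L -> cocircuit L c ->
  L y -> y != 0 -> supp y \subset supp c -> exists2 k, k != 0 & y = k *: c.
Proof.
move=> Llin [Lc c0 cmin] Ly y0 yc.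
have [i iy] := neq0_supp y0; have ic := fintype.subsetP yc _ iy.
have ci : c i 0 != 0 by apply/eqP/suppP.
have yi : y i 0 != 0 by apply/eqP/suppP.
exists (y i 0 / c i 0); first by rewrite mulf_neq0 ?invr_neq0.
apply/eqP; rewrite -subr_eq0; set w := _ - _; apply: contraTT ic => w0.
have Lw : L w by rewrite /w addrC -scaleNr; apply: Llin.
rewrite -(cmin w)// ; first by rewrite inE negbK !mxE divfK// subrr.
apply/fintype.subsetP => l; apply: contraLR => lc.
have := contra (fintype.subsetP yc l) lc.
move: lc; rewrite !inE !negbK !mxE => /eqP-> /eqP->.
by rewrite mulr0 subrr.
Qed.

(** The scalar is [y k / z k] of largest degree: it cancels the [k]-th
    entry, and any scalar of smaller degree would break the inequality at
    [k]. *)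
Lemma elimination y z : z != 0 -> supp z \subset supp y ->
  exists2 a, supp (y - a *: z) \proper supp y &
  forall l, (deg (y l 0%R) <= deg ((a *: z) l 0%R))%E.
Proof.
move=> z0 zy; have [k0 k0z] := neq0_supp z0.
pose q k := deg (y k 0 / z k 0).
case: (@Order.TotalTheory.arg_maxP _ _ _ k0 (mem (supp z)) q k0z) => k kz kmax.
have zk : z k 0 != 0 by apply/eqP/suppP.
exists (y k 0 / z k 0) => [|l].
  apply/fintype.properP; split; last first.
    exists k; first exact: fintype.subsetP zy _ kz.
    by rewrite inE negbK !mxE divfK// subrr.
  apply/fintype.subsetP => l; apply: contraLR => ly.
  have := contra (fintype.subsetP zy l) ly.
  move: ly; rewrite !inE !negbK !mxE => /eqP-> /eqP->.
  by rewrite mulr0 subrr.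
rewrite mxE; have [->|zl] := eqVneq (z l 0) 0; first by rewrite mulr0 deg0 leey.
rewrite -{1}(divfK zl (y l 0)) !degM; apply: leeD2r.
by rewrite -!degM; apply: kmax; apply/suppP/eqP.
Qed.

(** Induction on the support of [y]: when it is not minimal, both terms of
    [y = (y - a *: z) + a *: z] given by [elimination] have smaller support,
    and one of them keeps the degree of [y] at [i], since a sum of terms of
    larger degree would itself have larger degree. *)
Lemma cocircuit_dominating L y i : linear_space L -> L y -> i \in supp y ->
  exists c, [/\ cocircuit L c, forall l, (deg (y l 0%R) <= deg (c l 0%R))%E &
                (deg (c i 0%R) <= deg (y i 0%R))%E].
Proof.
move=> Llin; have [N] := ubnP #|supp y|.
elim: N y => // N IH y yN Ly iy.
have [cy|ncy] := pselect (cocircuit L y); first by exists y.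
have [z [Lz z0 zy zNy]] : exists z,
    [/\ L z, z != 0, supp z \subset supp y & supp z <> supp y].
  apply: contrapT => nz; apply: ncy; split=> // [|z Lz z0 zy].
    exact: supp_neq0 iy.
  by apply: contrapT => zNy; apply: nz; exists z.
have [a yaz ley] := elimination z0 zy.
suff [y' [Ly' y'y ley' y'i]] : exists y', [/\ L y', supp y' \proper supp y,
    forall l, (deg (y l 0%R) <= deg (y' l 0%R))%E &
    (deg (y' i 0%R) <= deg (y i 0%R))%E].
  have [||c [cL lec ci]] := IH y' _ Ly'.
  - by apply: leq_trans (fintype.proper_card y'y) _; rewrite -ltnS.
  - apply/suppP => /eqP; rewrite -deg_eqy; apply/negP.
    rewrite -ltey; apply: le_lt_trans y'i _; rewrite ltey deg_eqy.
    by apply/eqP/suppP.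
  exists c; split=> // [l|]; first exact: le_trans (lec l).
  exact: le_trans y'i.
have [azi|] := leP (deg ((a *: z) i 0)) (deg (y i 0)).
  exists (a *: z); split=> //; first exact: linear_spaceZ.
  apply: fintype.sub_proper_trans (_ : supp z \proper _).
    apply/fintype.subsetP => l; rewrite !inE mxE.
    by apply: contra => /eqP->; rewrite mulr0.
  by rewrite finset.properEneq zy andbT; apply/eqP.
move=> yi; exists (y - a *: z); split=> //.
- by rewrite addrC -scaleNr; apply: Llin.
- move=> l; rewrite mxE [X in (_ + X)%R]mxE; apply: degD => //.
  by rewrite degN.
- rewrite leNgt; apply/negP => lti.
  suff : (mine (deg ((y - a *: z) i 0)%R) (deg ((a *: z) i 0)%R)
            <= deg (y i 0%R))%E.
    by rewrite ge_min !leNgt lti yi.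
  rewrite -[y in leRHS](subrK (a *: z)) [in leRHS]mxE.
  by apply: degD; rewrite ge_min lexx ?orbT.
Qed.

End Cocircuits.

Lemma represented_of_deg_set_eq (R : realType) (n d : nat)
    (A : 'M[puiseux R]_(n, d)) c :
  deg_set (col_space A) = trop_image (map_mx (@deg R) A) ->
  cocircuit (col_space A) c -> represented A c.
Proof.
move=> eqA cA; have [Lc c0 _] := cA.
have [v Tv vc] : trop_image (map_mx (@deg R) A) (map_mx (@deg R) c).
  by rewrite -eqA; exists c.
have cE i : deg (c i 0) = trop_mulmx (map_mx (@deg R) A) v i 0.
  by rewrite vc mxE.
have [i ic] := neq0_supp c0.
have /bigmin_leP[|[j _ Aij]] :
    (\big[mine/+oo%E]_(j < d) (map_mx (@deg R) A i j + v j 0%R)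
       <= deg (c i 0%R))%E.
- by rewrite cE mxE.
- by rewrite leye_eq deg_eqy => /eqP ci; case/suppP: ic.
have ciy : (deg (c i 0%R) < +oo)%E by rewrite ltey deg_eqy; apply/eqP/suppP.
have := le_lt_trans Aij ciy; rewrite mxE => {}Aij.
have vj : v j 0 != +oo%E.
  by apply: contraTneq Aij => ->; rewrite addey// deg_neqNy.
have Aij0 : A i j != 0.
  by apply: contraTneq Aij => ->; rewrite deg0 addye// Tv.
exists j; apply: cocircuit_colinear cA _ _ _.
- exact: col_space_linear.
- by exists (delta_mx j 0) => //; rewrite -colE.
- by apply: (@supp_neq0 _ _ _ i); rewrite inE mxE.
apply/fintype.subsetP => l; rewrite !inE mxE.
apply: contra => /eqP cl; rewrite -deg_eqy.
have : (+oo <= deg (A l j) + v j 0%R)%E.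
  rewrite -(deg0 R) -cl cE mxE; apply: le_trans (bigmin_le _ j _) _.
  by rewrite mxE.
have [e ->] : exists e, v j 0 = e%:E.
  by exists (fine (v j 0)); rewrite fineK// fin_numE Tv.
by rewrite leye_eq; case: (deg _).
Qed.

Lemma deg_set_sub_trop_image (R : realType) (n d : nat)
    (A : 'M[puiseux R]_(n, d)) :
  (forall c, cocircuit (col_space A) c -> represented A c) ->
  deg_set (col_space A) `<=` trop_image (map_mx (@deg R) A).
Proof.
move=> rep _ [y Ly <-]; apply: trop_image_dominated => [i j|i].
  by rewrite mxE deg_neqNy.
rewrite mxE deg_eqy => yi.
have [||c [/rep[j [k k0 cE]] yc ci]] :=
    @cocircuit_dominating _ _ _ y i (@col_space_linear _ _ _ A) => //.
  by rewrite inE.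
exists (map_mx (@deg R) c); split=> [|l|]; rewrite ?mxE//.
by rewrite -[c](scalerK k0) -cE; exact: trop_image_col.
Qed.

Theorem theorem16 (R : realType) (n d : nat) (A : 'M[puiseux R]_(n, d)) :
  deg_set (col_space A) = trop_image (map_mx (@deg R) A) <->
  (forall c : 'cV[puiseux R]_n, cocircuit (col_space A) c -> represented A c).
Proof.
split=> [eqA c|rep]; first exact: represented_of_deg_set_eq.
apply/seteqP; split; first exact: deg_set_sub_trop_image.
exact: trop_image_sub_deg_set.
Qed.
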